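(* Let $(G,s,t)$ be a generalized cat$^1$-group. Then the triple $(\ker s,\operatorname{Im} s,\overline{t})$ is a generalized crossed module, where $\overline{t}=t|_{\ker s}$, the groups $\ker s$ and $\operatorname{Im} s$ carry the self-actions induced from the self-action of $G$, and $\operatorname{Im} s$ acts on $\ker s$ by $x\cdot g={}^{x}{g}$ for $x\in\operatorname{Im} s$, $g\in\ker s$.
   Context: Groups are written additively (not necessarily abelian). All actions of a group on a group are left actions by group automorphisms. A group with action is a group $G$ together with an action of $G$ on itself, written ${}^{g}{g_1}$ (not necessarily conjugation). A morphism of groups with action $f\colon G\to H$ is a group homomorphism with $f({}^{g}{g_1})={}^{f(g)}{f(g_1)}$ for all $g,g_1\in G$. A generalized cat$^1$-group $(G,s,t)$ is a group with action $G$ with two morphisms of groups with action $s,t\colon G\to G$ such that (i) $st=t$ and $ts=s$; (ii) ${}^{y}{x}=x$ for all $x\in\ker s$ and $y\in\ker t$. A generalized crossed module $(A,B,\alpha)$ consists of two groups with action $A,B$, a group homomorphism $\alpha\colon A\to B$ and an action $b\cdot a$ of the group $B$ on the group $A$ such that (i) $\alpha(b\cdot a)={}^{b}{\alpha(a)}$ and (ii) $\alpha(a)\cdot a_1={}^{a}{a_1}$ for all $a,a_1\in A$, $b\in B$. *)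

(* Defs.v *)
From HB Require Import structures.
From mathcomp Require Import all_boot.
From mathcomp Require Import boolp classical_sets.

Set Implicit Arguments.
Unset Strict Implicit.
Unset Printing Implicit Defensive.

Import Algebra.

Local Open Scope group_scope.

(* Group laws are written multiplicatively because the additive groups of the
   library are all abelian. *)

Record is_group_action (H A : groupType) (act : H -> A -> A) : Prop :=
  IsGroupAction {
    group_act1 : forall a, act 1 a = a;
    group_actM : forall h k a, act (h * k) a = act h (act k a);
    group_act_morph : forall h, {morph act h : a b / a * b}
  }.

HB.mixin Record Group_hasSelfAction G of Group G := {
  sact : G -> G -> G;
  sactP : is_group_action sact
}.

(* [sact g x] is the self-action of [g] on [x]; it is unrelated to the
   conjugation [x ^ g] of the library. *)
#[short(type="actGroupType")]
HB.structure Definition ActGroup := {G of Group_hasSelfAction G & Group G}.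

HB.mixin Record isSactMorphism (G H : actGroupType) (f : G -> H) := {
  sact_morph : forall g x, f (sact g x) = sact (f g) (f x)
}.

HB.structure Definition ActMorphism (G H : actGroupType) :=
  {f of @UMagmaMorphism G H f & isSactMorphism G H f}.

Notation "{ 'actmorphism' G -> H }" := (ActMorphism.type G H)
  (at level 0, G at level 98, H at level 99,
   format "{ 'actmorphism'  G  ->  H }") : type_scope.

Section KerIm.
Variables (G H : actGroupType) (f : {actmorphism G -> H}).

Definition kerg : {pred G} := [pred x | f x == 1].
Definition img : {pred H} := [pred y | y \in range f].

Lemma kerg_group_closed : group_closed kerg.
Proof.
split; first by rewrite inE gmulf1.
by move=> x y; rewrite !inE gmulfF /= => /eqP -> /eqP ->; rewrite divg1.
Qed.

Lemma kerg_sact g x : g \in kerg -> x \in kerg -> sact g x \in kerg.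
Proof.
by rewrite !inE sact_morph => /eqP -> /eqP ->; rewrite (group_act1 sactP).
Qed.

Lemma img_group_closed : group_closed img.
Proof.
split; first by apply/mem_set; exists 1 => //; rewrite gmulf1.
move=> _ _ /set_mem[x _ <-] /set_mem[y _ <-].
by apply/mem_set; exists (x / y) => //; rewrite gmulfF.
Qed.

Lemma img_sact g x : g \in img -> x \in img -> sact g x \in img.
Proof.
move=> /set_mem[y _ <-] /set_mem[z _ <-].
by apply/mem_set; exists (sact y z) => //; rewrite sact_morph.
Qed.

Definition ker_type := {x : G | x \in kerg}.
Definition im_type := {y : H | y \in img}.

HB.instance Definition _ := SubChoice.copy ker_type {x : G | x \in kerg}.
HB.instance Definition _ :=
  SubChoice_isSubGroup.Build G _ ker_type kerg_group_closed.

HB.instance Definition _ := SubChoice.copy im_type {y : H | y \in img}.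
HB.instance Definition _ :=
  SubChoice_isSubGroup.Build H _ im_type img_group_closed.

Definition ker_sact (g x : ker_type) : ker_type :=
  Sub (sact (val g) (val x)) (kerg_sact (valP g) (valP x)).

Definition im_sact (g x : im_type) : im_type :=
  Sub (sact (val g) (val x)) (img_sact (valP g) (valP x)).

Lemma ker_sactP : is_group_action ker_sact.
Proof.
split=> [x|g h x|g x y]; apply: val_inj; rewrite !SubK.
- exact: (group_act1 sactP).
- exact: (group_actM sactP).
- exact: (group_act_morph sactP).
Qed.

Lemma im_sactP : is_group_action im_sact.
Proof.
split=> [x|g h x|g x y]; apply: val_inj; rewrite !SubK.
- exact: (group_act1 sactP).
- exact: (group_actM sactP).
- exact: (group_act_morph sactP).
Qed.

HB.instance Definition _ := Group_hasSelfAction.Build ker_type ker_sactP.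
HB.instance Definition _ := Group_hasSelfAction.Build im_type im_sactP.

End KerIm.

Record gen_cat1_group (G : actGroupType) (s t : {actmorphism G -> G}) : Prop :=
  GenCat1Group {
    cat1_st : forall x, s (t x) = t x;
    cat1_ts : forall x, t (s x) = s x;
    cat1_ker : forall x y, x \in kerg s -> y \in kerg t -> sact y x = x
  }.

Record gen_crossed_module (A B : actGroupType) (alpha : A -> B)
    (dot : B -> A -> A) : Prop := GenCrossedModule {
  xmod_morph : monoid_morphism alpha;
  xmod_action : is_group_action dot;
  xmod_equivariant : forall b a, alpha (dot b a) = sact b (alpha a);
  xmod_peiffer : forall a a1, dot (alpha a) a1 = sact a a1
}.

(* Main.v *)
(* Both [s] and [t] are idempotent with image [Im s].  For the Peiffer identity,
   [t a = a * (a^-1 * t a)] and [a^-1 * t a] lies in [ker t], hence acts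
   trivially on [ker s]. *)
Require Import Defs.
From mathcomp Require Import all_boot.
From mathcomp Require Import classical_sets.

Import Algebra.

Local Open Scope group_scope.

(** The relations between [s] and [t] say that [t] takes values in [Im s] and fixes it pointwise
    ([cat1_t_img], [cat1_t_id]). Equivariance is then the compatibility of [t] with the self-action.
    The Peiffer identity holds because [a] and [t a] agree modulo [ker t], which acts trivially on
    [ker s] ([cat1_peiffer]). *)

Lemma group_act_on1 (H A : groupType) (act : H -> A -> A) :
  is_group_action act -> forall h, act h 1 = 1.
Proof.
move=> actP h; apply: (mulgI (act h 1)).
by rewrite -(group_act_morph actP) !mulg1.
Qed.

(** Unlike in [kerg_sact], [g] is arbitrary, so that [Im s] can act on [ker s]; it suffices that
    every action fixes [1]. *)
Lemma sact_ker (G H : actGroupType) (f : {actmorphism G -> H}) (g x : G) :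
  x \in kerg f -> sact g x \in kerg f.
Proof.
by rewrite !inE sact_morph => /eqP ->; rewrite (group_act_on1 _ _ _ sactP).
Qed.

(** Composing the two relations: [t t = t s t = s t = t]. *)
Lemma cat1_tt (G : actGroupType) (s t : {actmorphism G -> G})
    (Gst : gen_cat1_group s t) (x : G) : t (t x) = t x.
Proof. by rewrite -[in LHS](cat1_st Gst x) (cat1_ts Gst) (cat1_st Gst). Qed.

Lemma cat1_t_img (G : actGroupType) (s t : {actmorphism G -> G})
    (Gst : gen_cat1_group s t) (x : G) : t x \in img s.
Proof. by apply/mem_set; exists (t x) => //; apply: (cat1_st Gst). Qed.

Lemma cat1_t_id (G : actGroupType) (s t : {actmorphism G -> G})
    (Gst : gen_cat1_group s t) (x : G) : x \in img s -> t x = x.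
Proof. by move=> /set_mem[y _ <-]; apply: (cat1_ts Gst). Qed.

Lemma cat1_peiffer (G : actGroupType) (s t : {actmorphism G -> G})
    (Gst : gen_cat1_group s t) (a x : G) :
  x \in kerg s -> sact (t a) x = sact a x.
Proof.
move=> xK; have yK : a^-1 * t a \in kerg t.
  by rewrite inE gmulfM gmulfV /= (cat1_tt _ _ _ Gst) mulVg.
by rewrite -[t a](mulVKg a) (group_actM sactP) (cat1_ker Gst xK yK).
Qed.

Theorem proposition2p1 (G : actGroupType) (s t : {actmorphism G -> G})
    (Gst : gen_cat1_group s t) :
  exists (tbar : ker_type s -> im_type s)
         (dot : im_type s -> ker_type s -> ker_type s),
    [/\ forall g, val (tbar g) = t (val g),
        forall x g, val (dot x g) = sact (val x) (val g)
      & gen_crossed_module tbar dot].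
Proof.
pose tbar (g : ker_type s) : im_type s :=
  Sub (t (val g)) (cat1_t_img _ _ _ Gst _).
pose dot (x : im_type s) (g : ker_type s) : ker_type s :=
  Sub (sact (val x) (val g)) (sact_ker _ _ _ _ _ (valP g)).
have tbarE g : val (tbar g) = t (val g) by rewrite SubK.
have dotE x g : val (dot x g) = sact (val x) (val g) by rewrite SubK.
exists tbar, dot; split=> //; split.
- split=> [|g h]; apply: val_inj.
    exact: gmulf1.
  exact: (gmulfM (val g) (val h)).
- split=> [x|g h x|g x y]; apply: val_inj.
  + exact: (group_act1 sactP).
  + exact: (group_actM sactP).
  + exact: (group_act_morph sactP).
(* Applying [t] turns the acting element [b] into [t b], which is [b] again since [b] lies in
   [Im s]. *)
- move=> b a; apply: val_inj; rewrite [LHS]tbarE dotE sact_morph.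
  by rewrite (cat1_t_id _ _ _ Gst _ (valP b)).
- move=> a x; apply: val_inj; rewrite [LHS]dotE tbarE.
  exact: (cat1_peiffer _ _ _ Gst _ _ (valP x)).
Qed.
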